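(* Let $T\ge 2$ and $N\ge1$ be integers, $\epsilon\in(0,1)$, $\bm\mu\in\mathbb R^N$, $\bm\Sigma=[\sigma_{ij}]\in\mathbb S^N$ with $\bm\Sigma\succ\bm0$, and let $\rho_0,\dots,\rho_{T-1}\in\mathbb R$ satisfy $\rho_0=1$, $\rho_t=\rho_{T-t}$ for $t=1,\dots,T-1$, and $\mathrm{circ}(\rho_0,\dots,\rho_{T-1})\succ\bm0$. Let $\mathcal P$ be the set of all probability distributions $\mathbb P$ of random vectors $(\tilde{\bm r}_1,\dots,\tilde{\bm r}_T)\in\mathbb R^{NT}$ (each $\tilde{\bm r}_t=(\tilde r_{t,1},\dots,\tilde r_{t,N})\in\mathbb R^N$) with finite second moments such that $\mathbb E_{\mathbb P}(\tilde r_{t,i})=\mu_i$ for all $i,t$ and $\mathrm{Cov}_{\mathbb P}(\tilde r_{s,i},\tilde r_{t,j})=\rho_{(t-s)\bmod T}\,\sigma_{ij}$ for all $i,j\in\{1,\dots,N\}$, $s,t\in\{1,\dots,T\}$. For $\bm w\in\mathbb R^N_+$ define the worst-case growth rate $$\mathcal G_\epsilon(\bm w)=\sup\Big\{\gamma\in\mathbb R:\ \mathbb P\Big(\tfrac1T\textstyle\sum_{t=1}^T\big(\bm w^\intercal\tilde{\bm r}_t-\tfrac12(\bm w^\intercal\tilde{\bm r}_t)^2\big)\ge\gamma\Big)\ge 1-\epsilon\ \ \forall\,\mathbb P\in\mathcal P\Big\}.$$ Let $\bar\rho=\frac{1}{T-1}\sum_{t=1}^{T-1}\rho_t$. If $\bm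 w\in\mathbb R^N_+$ satisfies $$1-\bm w^\intercal\bm\mu>\sqrt{\frac{(1+(T-1)\bar\rho)\epsilon}{(1-\epsilon)T}}\,\|\bm\Sigma^{1/2}\bm w\|,$$ then $$\mathcal G_\epsilon(\bm w)=\frac12\left(1-\left(1-\bm w^\intercal\bm\mu+\sqrt{\frac{(1-\epsilon)(1+(T-1)\bar\rho)}{\epsilon T}}\,\|\bm\Sigma^{1/2}\bm w\|\right)^2-\frac{T-1-(T-1)\bar\rho}{\epsilon T}\,\bm w^\intercal\bm\Sigma\bm w\right).$$
   Context: $\mathbb S^N$ is the set of real symmetric $N\times N$ matrices; $\bm\Sigma^{1/2}$ is the principal (positive semidefinite) square root; $\|\cdot\|$ is the Euclidean norm. $\mathrm{circ}(c_0,\dots,c_{T-1})$ denotes the $T\times T$ circulant matrix with $(s,t)$ entry $c_{(t-s)\bmod T}$. The vector $\bm w$ represents a fixed-mix portfolio re-balanced to the same weights in each of the $T$ periods, and $\tilde{\bm r}_t$ the asset returns in period $t$. *)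

(* Defs.v *)
From HB Require Import structures.
From mathcomp Require Import all_boot all_order all_algebra.
From mathcomp Require Import all_classical all_reals all_analysis.
Set Implicit Arguments. Unset Strict Implicit. Unset Printing Implicit Defensive.
Import Order.TTheory GRing.Theory Num.Theory.
Local Open Scope classical_set_scope.
Local Open Scope ring_scope.

Definition posdef (R : realType) (n : nat) (A : 'M[R]_n) : Prop :=
  forall x : 'cV[R]_n, x != 0 -> 0 < (x^T *m A *m x) 0 0.

Definition circ (R : realType) (T : nat) (c : nat -> R) : 'M[R]_T :=
  \matrix_(s < T, t < T) c ((t + T - s) %% T)%N.

Definition in_ambiguity_set (R : realType) (T N : nat)
    (mu : 'cV[R]_N) (Sigma : 'M[R]_N) (rho : nat -> R)
    d (Omega : measurableType d) (P : probability Omega R)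
    (r : 'I_T -> 'I_N -> Omega -> R) : Prop :=
  (forall t i, r t i \in Lfun P 2%:E) /\
  (forall t i, ('E_P[r t i])%E = (mu i 0)%:E) /\
  (forall s t i j, covariance P (r s i) (r t j) =
       (rho ((t + T - s) %% T)%N * Sigma i j)%:E).

Definition port_ret (R : realType) (T N : nat) (Omega : Type)
    (w : 'cV[R]_N) (r : 'I_T -> 'I_N -> Omega -> R) (t : 'I_T) (x : Omega) : R :=
  \sum_(i < N) w i 0 * r t i x.

Definition avg_growth (R : realType) (T N : nat) (Omega : Type)
    (w : 'cV[R]_N) (r : 'I_T -> 'I_N -> Omega -> R) (x : Omega) : R :=
  T%:R^-1 * \sum_(t < T) (port_ret w r t x - 2^-1 * (port_ret w r t x) ^+ 2).

Definition worst_growth (R : realType) (T N : nat) (eps : R)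
    (mu : 'cV[R]_N) (Sigma : 'M[R]_N) (rho : nat -> R) (w : 'cV[R]_N) : R :=
  sup [set gamma : R | forall d (Omega : measurableType d)
         (P : probability Omega R) (r : 'I_T -> 'I_N -> Omega -> R),
         in_ambiguity_set mu Sigma rho P r ->
         (P [set x | (gamma <= avg_growth w r x)%R] >= (1 - eps)%:E)%E].

(* ||Sigma^{1/2} w|| = sqrt (w^T Sigma w) *)
Definition sqrt_quad (R : realType) (N : nat) (Sigma : 'M[R]_N) (w : 'cV[R]_N) : R :=
  Num.sqrt ((w^T *m Sigma *m w) 0 0).

(* Main.v *)
(** Put [u_t = 1 - w^T r_t]; the growth rate is [(1 - |u|^2 / T) / 2], so one needs
the worst-case [(1 - eps)]-quantile of [|u|^2 / T = a^2 + |b|^2 / T], where [a] is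
the time average of [u] and [b] its centered part.  With [m = 1 - w^T mu],
[v = w^T Sigma w] and [S = rho_0 + ... + rho_(T-1)], the average has mean [m] and
variance [s^2 = v S / T], and [E |b|^2 / T = q := v (1 - S / T)].  With
[k^2 = (1 - eps) / eps] the quantile is [(m + k s)^2 + q / eps].

It is an upper bound by a Chebyshev argument: a suitable combination of
[(a - (m - s / k))^2] and [|b|^2 / T] dominates the indicator of the bad event, the
hypothesis [s / k < m] being what makes this work.

It is sharp: with probability [1 / (1 + x^2)], for [x < k], let [a = m + x s] and let
[b] have constant norm, and otherwise let [a = m - s / x] and [b = 0]; then let [x]
tend to [k].  A law of given covariance [B = sum_j h_j h_j^T] and constant norm is
obtained by drawing a fixed multiple of [+- h_j / |h_j|] with probability proportional to [|h_j|^2]. The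
covariance of the asset returns orthogonal to [w] is realised on the second event.
*)

Require Import Defs.
From HB Require Import structures.
From mathcomp Require Import all_boot all_order all_algebra.
From mathcomp Require Import all_classical all_reals all_analysis.
From mathcomp Require Import measurable_realfun.
From mathcomp Require Import zify ring lra.
Import Order.TTheory GRing.Theory Num.Theory.
Local Open Scope ring_scope.

(** * Quadratic forms and Cholesky factorisation *)

Lemma mx_bilinE {R : comNzRingType} {m n : nat} (x : 'cV[R]_m) (A : 'M[R]_(m, n))
    (y : 'cV[R]_n) :
  (x^T *m A *m y) 0 0 = \sum_i \sum_j x i 0 * A i j * y j 0.
Proof.
rewrite mxE exchange_big /=; apply: eq_bigr => j _.
by rewrite mxE mulr_suml; apply: eq_bigr => i _; rewrite mxE.
Qed.

(** Cholesky factorisation by induction on the size: eliminate the first coordinate and factor the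
    Schur complement [D'] of the corner entry [a]. *)
Lemma posdef_factor {R : realType} {n : nat} (A : 'M[R]_n) :
  A^T = A -> posdef A -> exists H : 'M[R]_n, A = H *m H^T.
Proof.
elim: n A => [|n IH] A symA posA; first by exists 0; rewrite [LHS]flatmx0 [RHS]flatmx0.
move: A symA posA; change n.+1 with (1 + n)%N => A symA posA.
pose a := ulsubmx A 0 0; pose b := dlsubmx A; pose D := drsubmx A.
have defA : A = block_mx a%:M b^T b D.
  rewrite -[LHS]submxK -/b -/D -mx11_scalar; congr block_mx.
  by rewrite /b trmx_dlsub symA.
have a_gt0 : 0 < a.
  have e0 : col_mx 1%:M (0 : 'cV[R]_n) != 0.
    apply/eqP => /(congr1 usubmx); rewrite col_mxKu => /matrixP/(_ 0 0).
    by rewrite linear0 !mxE => /eqP; rewrite oner_eq0.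
  move/(_ _ e0): posA; rewrite defA tr_col_mx mul_row_block mul_row_col.
  by rewrite !trmx0 !mul0mx !mulmx0 !addr0 trmx1 mul1mx mulmx1 mxE mulr1n.
have a0 : a != 0 by rewrite gt_eqF.
pose D' := D - a^-1 *: (b *m b^T).
have symD : D^T = D by rewrite /D trmx_drsub symA.
have [||H DH] := IH D'.
- by rewrite /D' linearB linearZ /= trmx_mul trmxK symD.
- move=> x x0.
  (* The first coordinate minimises the form of [A] with [x] held fixed, and the minimum is the form
     of [D'] at [x]; hence [D'] inherits positivity. *)
  pose z : 'cV[R]_(1 + n) := col_mx (- a^-1 *: (b^T *m x)) x.
  have z0 : z != 0.
    apply: contra_neq x0 => /(congr1 dsubmx).
    by rewrite /z col_mxKd linear0.
  move/(_ _ z0): posA; rewrite defA /z tr_col_mx mul_row_block mul_row_col.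
  set e := (X in 0 < X -> _); suff -> : e = (x^T *m D' *m x) 0 0 by [].
  rewrite {}/e /D'; congr (fun_of_matrix _ _ _).
  have -> : (- a^-1 *: (b^T *m x))^T = - a^-1 *: (x^T *m b).
    by rewrite linearZ /= trmx_mul trmxK.
  rewrite mul_mx_scalar scalerA mulrN divff // scaleN1r addNr mul0mx add0r.
  rewrite mulmxDl mulmxBr mulmxBl -!scalemxAr -!scalemxAl !mulmxA.
  by rewrite addrC scaleNr.
pose r := Num.sqrt a.
have rr : r * r = a by rewrite -expr2 sqr_sqrtr // ltW.
have r0 : r != 0 by apply: contra_neq a0 => r0; rewrite -rr r0 mul0r.
exists (block_mx r%:M 0 (r^-1 *: b) H : 'M[R]_(1 + n)).
rewrite defA tr_block_mx mulmx_block trmx0 !mulmx0 !mul0mx !addr0.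
rewrite tr_scalar_mx -scalar_mxM rr linearZ /= mul_mx_scalar mul_scalar_mx.
rewrite !scalerA divff // !scale1r -scalemxAr -scalemxAl scalerA -invfM rr.
by rewrite -DH /D' addrC subrK.
Qed.

(** * Row sums of the circulant correlation matrix *)

Section Circulant.
Context {R : realType} {T : nat} (rho : nat -> R).
Local Notation S := (\sum_(0 <= k < T) rho k).

Lemma sum_circ_row (s : 'I_T) : \sum_t circ T rho s t = S.
Proof.
rewrite big_mkord; case: T s => [[] //|n] s.
rewrite [RHS](reindex_inj (addIr (- s))) /=; apply: eq_bigr => t _.
by rewrite mxE modnDmr addnBA // ltnW.
Qed.

Hypothesis rho_sym : forall t, (1 <= t <= T - 1)%N -> rho t = rho (T - t)%N.

Lemma circ_sym : (circ T rho)^T = circ T rho.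
Proof.
apply/matrixP => s t; rewrite !mxE.
wlog st : s t / (s < t)%N => [wh|].
  case: (ltngtP s t) => [||/ord_inj -> //]; first exact: wh.
  by move=> ts; rewrite [RHS](wh t s).
have tT := ltn_ord t.
have -> : ((s + T - t) %% T = T - (t - s))%N.
  by rewrite modn_small; lia.
have -> : ((t + T - s) %% T = t - s)%N.
  by rewrite -addnBAC ?modnDr ?modn_small //; lia.
by rewrite -rho_sym //; lia.
Qed.

Lemma sum_circ_col (t : 'I_T) : \sum_s circ T rho s t = S.
Proof.
by rewrite -(sum_circ_row t); apply: eq_bigr => s _; rewrite -[in LHS]circ_sym mxE.
Qed.

Hypotheses (T2 : (2 <= T)%N) (rho0 : rho 0%N = 1).
Hypothesis pos_circ : posdef (circ T rho).

Let T0 : T%:R != 0 :> R.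
Proof. by rewrite pnatr_eq0 -lt0n (ltn_trans _ T2). Qed.

Lemma circ_diag (s : 'I_T) : circ T rho s s = 1.
Proof. by rewrite mxE addnC addnK modnn. Qed.

(** The form of the circulant at the all-ones vector is [T%:R * S]. *)
Lemma sum_circ_gt0 : 0 < S.
Proof.
have T1 : (0 < T)%N by lia.
have x0 : const_mx 1 != 0 :> 'cV[R]_T.
  by apply/eqP => /matrixP/(_ (Ordinal T1) 0)/eqP; rewrite !mxE oner_eq0.
have := pos_circ _ x0; rewrite mx_bilinE.
under eq_bigr => i _ do under eq_bigr => j _ do rewrite !mxE mul1r mulr1.
have -> : \sum_(i < T) \sum_(j < T) rho ((j + T - i) %% T)%N = T%:R * S.
  rewrite mulr_natl -[X in _ *+ X]card_ord -sumr_const.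
  apply: eq_bigr => i _; rewrite -(sum_circ_row i).
  by apply: eq_bigr => j _; rewrite mxE.
by rewrite pmulr_rgt0 // ltr0n.
Qed.

(** Test positivity on a unit vector minus its mean. As all row and column sums equal [S], the form
    there is [1 - S / T%:R]; [2 <= T] makes the vector nonzero. *)
Lemma sum_circ_lt : S < T%:R.
Proof.
have T1 : (0 < T)%N by lia.
pose i0 := Ordinal T1; pose i1 := Ordinal T2.
pose x : 'cV[R]_T := \col_i ((i == i0)%:R - T%:R^-1).
have x0 : x != 0.
  apply/eqP => /matrixP/(_ i1 0)/eqP.
  by rewrite !mxE sub0r oppr_eq0 invr_eq0 (negbTE T0).
have delta (F : 'I_T -> R) : \sum_i F i * (i == i0)%:R = F i0.
  by rewrite (bigD1 i0) //= mulr1 big1 ?addr0 // => i /negbTE ->; rewrite mulr0.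
have := pos_circ _ x0; rewrite mx_bilinE.
under eq_bigr => i _.
  under eq_bigr => j _ do rewrite -mulrA [x j 0]mxE mulrBr.
  rewrite -mulr_sumr sumrB -mulr_suml sum_circ_row delta mxE mulrC mulrBr.
  over.
rewrite sumrB delta -mulr_suml sumrB sum_circ_col sumr_const card_ord circ_diag.
rewrite -(mulr_natl (_ / _)) mulrCA mulfV // mulr1 subrr mul0r subr0.
by rewrite subr_gt0 ltr_pdivrMr ?mul1r // ltr0n.
Qed.
End Circulant.

(** * Expectations of linear and bilinear combinations *)

Section ExpectationSums.
Local Open Scope classical_set_scope.
Context {d} {Omega : measurableType d} {R : realType} (P : probability Omega R).

Lemma Lfun2_Lfun1 {X : Omega -> R} : X \in Lfun P 2%:E -> X \in Lfun P 1.
Proof. by apply: Lfun_subset12; exact: fin_num_measure. Qed.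

Lemma Lfun_sum {I : finType} (p : R) (X : I -> Omega -> R) (a : I -> R) :
  1 <= p -> (forall i, X i \in Lfun P p%:E) ->
  (fun x => \sum_i a i * X i x) \in Lfun P p%:E.
Proof.
move=> p1 LX.
have -> : (fun x => \sum_i a i * X i x) = \sum_i (a i \o* X i).
  by apply/funext => x; rewrite fct_sumE; apply: eq_bigr => i _ /=; rewrite mulrC.
by apply: rpred_sum => // i _; apply: Lfun_scale.
Qed.

Lemma expectation_lincomb {I : finType} (X : I -> Omega -> R) (a e : I -> R) :
  (forall i, X i \in Lfun P 1) -> (forall i, 'E_P[X i] = (e i)%:E)%E ->
  ('E_P[(fun x => \sum_i a i * X i x)%R] = (\sum_i a i * e i)%R%:E)%E.
Proof.
move=> LX EX.
pose Xs := [seq (a i \o* X i)%R | i <- enum I].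
have -> : (fun x => \sum_i a i * X i x) = \sum_(Y <- Xs) Y.
  apply/funext => x; rewrite big_map big_enum /= fct_sumE.
  by apply: eq_bigr => i _ /=; rewrite mulrC.
rewrite expectation_sum; last first.
  by move=> _ /mapP[i _ ->]; apply: Lfun_scale.
rewrite big_map big_enum /= -sumEFin; apply: eq_bigr => i _.
by rewrite expectationZl // EX EFinM.
Qed.

Lemma expectation_bilin {I J : finType} (X : I -> Omega -> R) (Y : J -> Omega -> R)
    (a : I -> R) (b : J -> R) (K : I -> J -> R) :
  (forall i, X i \in Lfun P 2%:E) -> (forall j, Y j \in Lfun P 2%:E) ->
  (forall i j, 'E_P[(fun x => X i x * Y j x)%R] = (K i j)%:E)%E ->
  ('E_P[(fun x => (\sum_i a i * X i x) * (\sum_j b j * Y j x))%R] =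
   (\sum_i \sum_j a i * b j * K i j)%R%:E)%E.
Proof.
move=> LX LY EXY.
rewrite pair_big /= -(@expectation_lincomb _ (fun ij x => X ij.1 x * Y ij.2 x)
  (fun ij => a ij.1 * b ij.2) (fun ij => K ij.1 ij.2)) => [|ij|ij].
- congr (expectation P _); apply/funext => x; rewrite mulr_suml.
  rewrite -(pair_bigA _ (fun i j => a i * b j * (X i x * Y j x))) /=.
  by apply: eq_bigr => i _; rewrite mulr_sumr; apply: eq_bigr => j _; ring.
- exact: Lfun2_mul_Lfun1.
- exact: EXY.
Qed.

End ExpectationSums.

(** * Finitely supported laws *)

Section FiniteProbability.
Local Open Scope classical_set_scope.
Context {R : realType} {K : finType} (p : K -> R) (k0 : K).
Hypotheses (p_ge0 : forall k, 0 <= p k) (p_sum : \sum_k p k = 1).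

(* The points of [K] are numbered by [enum K], so that the sample space can be
   [nat], on which every set is measurable. *)
Let pt (n : nat) : K := nth k0 (enum K) n.
Let mu (n : nat) : {measure set nat -> \bar R} :=
  mscale (NngNum (p_ge0 (pt n))) \d_n.
Definition weighted_diracs : set nat -> \bar R := msum mu #|K|.
Local Notation Q := weighted_diracs.

HB.instance Definition _ := Measure.on Q.

Let sum_pt (f : K -> R) : \sum_(n < #|K|) f (pt n) = \sum_k f k.
Proof.
by rewrite -[RHS]big_enum /= (big_nth k0) -cardE big_mkord.
Qed.

Let Q_setT : Q setT = 1%E.
Proof.
rewrite /weighted_diracs /msum /= /mscale /=.
under eq_bigr => i _ do rewrite diracT mule1.
by rewrite sumEFin sum_pt p_sum.
Qed.

HB.instance Definition _ := Measure_isProbability.Build _ _ _ Q Q_setT.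

Let Qp : probability nat R := Q.

Let ge0_int (f : nat -> R) : (forall n, 0 <= f n) ->
  (\int[Qp]_n (f n)%:E = (\sum_(n < #|K|) p (pt n) * f n)%R%:E)%E.
Proof.
move=> f0.
transitivity (\int[Q]_n (f n)%:E)%E; first by [].
rewrite ge0_integral_measure_sum // => [|n _]; last by rewrite lee_fin.
rewrite -sumEFin; apply: eq_bigr => i _.
rewrite ge0_integral_mscale //= => [|n _]; last by rewrite lee_fin.
by rewrite integral_dirac //= diracT mul1e.
Qed.

(** This reduces every moment of the extremal law to a finite sum over its scenarios. *)
Lemma finite_probability : exists (P : probability nat R) (x : nat -> K),
  forall f : K -> R, (f \o x \in Lfun P 2%:E) /\
    ('E_P[f \o x] = (\sum_k p k * f k)%R%:E)%E.
Proof.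
exists Qp, pt => f.
have Lf (g : K -> R) : g \o pt \in Lfun Qp 2%:E.
  apply/andP; split; first by rewrite inE.
  rewrite inE /= /finite_norm unlock /Lnorm poweR_lty //.
  under eq_integral => x _ do rewrite poweR_EFin.
  rewrite ge0_int => [|n]; last by rewrite powR_ge0.
  by rewrite ltry.
split=> //.
(* The integral formula [ge0_int] covers nonnegative functions only; adding the constant [M] makes
   [f] nonnegative, and its expectation is subtracted at the end. *)
pose M := \sum_k `|f k|.
have fM k : 0 <= f k + M.
  rewrite /M (bigD1 k) //=.
  have : 0 <= \sum_(i | i != k) `|f i| by apply: sumr_ge0.
  by have := ler_norm (- f k); rewrite normrN; lra.
have := ge0_int (fun n => f (pt n) + M) (fun n => fM (pt n)).
have := expectationD (Lfun2_Lfun1 _ (Lf f)) (Lfun_cst Qp M 1).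
rewrite expectation_cst [in X in X = _ -> _]unlock /= => -> .
rewrite (sum_pt (fun k => p k * (f k + M))).
rewrite (eq_bigr (fun k => p k * f k + p k * M)) => [|k _]; last exact: mulrDr.
rewrite big_split /= -mulr_suml p_sum mul1r EFinD.
by move/(congr1 (fun z => z - M%:E)%E); rewrite !addeK.
Qed.

End FiniteProbability.

(** * Moments of the portfolio return under an admissible law *)

Section PortfolioMoments.
Local Open Scope classical_set_scope.
Context {R : realType} {T N : nat} (mu : 'cV[R]_N) (Sigma : 'M[R]_N).
Context (rho : nat -> R) (w : 'cV[R]_N) {d} {Omega : measurableType d}.
Context (P : probability Omega R) (r : 'I_T -> 'I_N -> Omega -> R).
Hypothesis rP : in_ambiguity_set mu Sigma rho P r.

Let c t i x := r t i x - mu i 0.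

Let port_dev t x : port_ret w r t x - (w^T *m mu) 0 0 = \sum_i w i 0 * c t i x.
Proof.
rewrite mxE /port_ret -sumrB; apply: eq_bigr => i _.
by rewrite mxE -mulrBr.
Qed.

Let Lc t i : c t i \in Lfun P 2%:E.
Proof.
have [Lr _] := rP.
rewrite (_ : c t i = r t i \- cst (mu i 0)) // rpredB ?lee1n ?Lr //= => _.
exact: Lfun_cst.
Qed.

Let Ec t i : ('E_P[c t i] = 0)%E.
Proof.
have [Lr [Er _]] := rP.
rewrite (_ : c t i = r t i \- cst (mu i 0)) // expectationB.
- by rewrite Er expectation_cst subee.
- exact: Lfun2_Lfun1.
- exact: Lfun_cst.
Qed.

Let Ecc s t i j :
  ('E_P[(fun x => c s i x * c t j x)%R] = (circ T rho s t * Sigma i j)%:E)%E.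
Proof.
by have [_ [Er]] := rP => /(_ s t i j); rewrite unlock !Er mxE => <-.
Qed.

Lemma port_dev_Lfun2 t :
  (fun x => port_ret w r t x - (w^T *m mu) 0 0) \in Lfun P 2%:E.
Proof. by under eq_fun do rewrite port_dev; apply: Lfun_sum => //; lra. Qed.

Lemma expectation_port_dev t :
  ('E_P[(fun x => port_ret w r t x - (w^T *m mu) 0 0)%R] = 0)%E.
Proof.
under eq_fun do rewrite port_dev.
rewrite (expectation_lincomb P _ _ (fun=> 0)) //.
- by rewrite big1 // => i _; rewrite mulr0.
- by move=> i; apply: Lfun2_Lfun1.
Qed.

Lemma expectation_port_dev_mul s t :
  ('E_P[(fun x => (port_ret w r s x - (w^T *m mu) 0 0) *
                  (port_ret w r t x - (w^T *m mu) 0 0))%R] =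
   ((w^T *m Sigma *m w) 0 0 * circ T rho s t)%:E)%E.
Proof.
under eq_fun do rewrite !port_dev.
rewrite (expectation_bilin P _ _ _ _ (fun i j => circ T rho s t * Sigma i j)) //.
rewrite mx_bilinE mulr_suml; congr EFin; apply: eq_bigr => i _.
by rewrite mulr_suml; apply: eq_bigr => j _; ring.
Qed.

End PortfolioMoments.

(** * The Chebyshev-type upper bound on the quantile *)

Section QuantileBound.
Local Open Scope classical_set_scope.
Context {R : realType} {T : nat} {d} {Omega : measurableType d}.
Context (P : probability Omega R) (D : 'I_T -> Omega -> R).
Context (C : 'I_T -> 'I_T -> R) (v S m s k eps : R).
Hypotheses (LD : forall t, D t \in Lfun P 2%:E) (ED : forall t, ('E_P[D t] = 0)%E).
Hypothesis EDD : forall t u, ('E_P[(fun x => D t x * D u x)%R] = (v * C t u)%:E)%E.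
Hypotheses (Cdiag : forall t, C t t = 1) (Csum : \sum_t \sum_u C t u = T%:R * S).
Hypotheses (T_gt0 : (0 < T)%N) (v_ge0 : 0 <= v) (S_le : S <= T%:R).
Hypotheses (s_gt0 : 0 < s) (ssE : s ^+ 2 = v * S / T%:R).
Hypotheses (k_gt0 : 0 < k) (epsE : eps * (1 + k ^+ 2) = 1) (m_gt : s / k < m).

Let T0 : T%:R != 0 :> R.
Proof. by rewrite pnatr_eq0 -lt0n. Qed.

Let b x := \sum_t T%:R^-1 * D t x.
Let V x := \sum_t T%:R^-1 * D t x ^+ 2.

(** Used with [c = m], for the event to be bounded, and with [c = b x], for the nonnegativity of the
    variance over time [V x - b x ^+ 2]. *)
Let ZE c x : T%:R^-1 * \sum_t (c - D t x) ^+ 2 = c ^+ 2 - 2 * c * b x + V x.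
Proof.
have -> : \sum_t (c - D t x) ^+ 2 =
    \sum_t (c ^+ 2 - 2 * c * D t x + D t x ^+ 2) by apply: eq_bigr => t _; ring.
rewrite big_split sumrB /= sumr_const card_ord -(mulr_natl (c ^+ 2)) -mulr_sumr.
rewrite mulrDr mulrBr mulKf // /V /b -!mulr_sumr.
by congr (_ - _ + _); ring.
Qed.

(** Markov's inequality for a function [f] quadratic in the deviations: its expectation depends only
    on the prescribed moments, so the bound is uniform over the admissible laws. *)
Lemma mean_sqr_quantile :
  ((1 - eps)%:E <= P [set x | (T%:R^-1 * \sum_t (m - D t x) ^+ 2 <=
     (m + k * s) ^+ 2 + v * (1 - S / T%:R) * (1 + k ^+ 2))%R])%E.
Proof.
set L := (m + k * s) ^+ 2 + _; set A := [set x | _].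
pose q := v * (1 - S / T%:R).
have q_ge0 : 0 <= q.
  by rewrite mulr_ge0 // subr_ge0 ler_pdivrMr ?mul1r // ltr0n.
pose h := k * s + s / k.
have h_gt0 : 0 < h by rewrite addr_gt0 ?mulr_gt0 ?invr_gt0.
(* With this slope the numerator of [f] below and the mean square have the same derivative in [b x]
   at [- k * s], so up to a constant they differ by [(al - 1) * (b x + k * s) ^+ 2]. The hypothesis
   [s / k < m] yields [1 <= al]. *)
pose al := (m + k * s) / h.
have alh : al * h = m + k * s by rewrite /al divfK // gt_eqF.
have al_ge1 : 1 <= al.
  by rewrite /al ler_pdivlMr // mul1r /h addrC lerD2r ltW.
(* The numerator of [f] at an unfavourable atom, where [b x = - k * s] and
   [V x - b x ^+ 2 = q * (1 + k ^+ 2)]. *)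
pose itau := (m + k * s) * h + q * (1 + k ^+ 2).
have mks : 0 < m + k * s by rewrite -alh mulr_gt0 //; lra.
have itau_gt0 : 0 < itau.
  by rewrite ltr_pwDl ?mulr_gt0 // mulr_ge0 // addr_ge0 // sqr_ge0.
(* The dual certificate: a quadratic that is nonnegative, at least [1] off [A],
   and has expectation [eps]; it vanishes at the favourable atom of the extremal
   law and equals [1] at the unfavourable ones. *)
pose f x := itau^-1 * (al * (s / k - b x) ^+ 2 + (V x - b x ^+ 2)).
have varb_ge0 x : 0 <= V x - b x ^+ 2.
  have -> : V x - b x ^+ 2 = T%:R^-1 * \sum_t (b x - D t x) ^+ 2.
    by rewrite ZE; ring.
  by rewrite mulr_ge0 ?invr_ge0 // sumr_ge0 // => t _; rewrite sqr_ge0.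
have f_ge0 x : 0 <= f x.
  rewrite mulr_ge0 ?invr_ge0 ?(ltW itau_gt0) // addr_ge0 // mulr_ge0 ?sqr_ge0 //.
  lra.
have f_ge1 x : (~` A) x -> 1 <= f x.
  move=> /= /negP; rewrite -ltNge ZE => LZ.
  rewrite ler_pdivlMl // mulr1.
  have -> : al * (s / k - b x) ^+ 2 + (V x - b x ^+ 2) =
      itau + (m ^+ 2 - 2 * m * b x + V x - L) + (al - 1) * (b x + k * s) ^+ 2.
    rewrite /L /itau -/q.
    have -> : m = al * h - k * s by rewrite alh addrK.
    by rewrite /h; ring.
  have : 0 <= (al - 1) * (b x + k * s) ^+ 2.
    by rewrite mulr_ge0 ?sqr_ge0 // subr_ge0.
  by lra.
have Lb : b \in Lfun P 2%:E by apply: Lfun_sum => //; lra.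
have mD t : measurable_fun setT (D t).
  by have /sub_Lfun_mfun := LD t; rewrite inE.
have mb : measurable_fun setT b by have /sub_Lfun_mfun := Lb; rewrite inE.
have mV : measurable_fun setT V.
  apply: measurable_sum => t; apply: measurable_funM => //.
  exact: measurable_funX.
have mZ : measurable_fun setT (fun x => m ^+ 2 - 2 * m * b x + V x).
  apply: measurable_funD => //; apply: measurable_funB => //.
  exact: measurable_funM.
have mf : measurable_fun setT f.
  apply: measurable_funM => //; apply: measurable_funD; last first.
    by apply: measurable_funB => //; exact: measurable_funX.
  apply: measurable_funM => //; apply: measurable_funX.
  exact: measurable_funB.
have mA : measurable A.
  have -> : A = setT `&` (fun x => m ^+ 2 - 2 * m * b x + V x) @^-1` `]-oo, L].
    by rewrite setTI; apply/seteqP; split=> x; rewrite /A /= ZE in_itv.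
  exact: mZ.
have EV : ('E_P[V] = v%:E)%E.
  rewrite (expectation_lincomb P (fun t x => D t x ^+ 2) _ (fun=> v)).
  - by rewrite -mulr_sumr sumr_const card_ord -(mulr_natl v) mulKf.
  - by move=> t; apply: (Lfun2_mul_Lfun1 (LD t) (LD t)).
  - by move=> t; rewrite (EDD t t) Cdiag mulr1.
have Ebb : ('E_P[(fun x => b x ^+ 2)%R] = (s ^+ 2)%:E)%E.
  rewrite (expectation_bilin P D D _ _ (fun t u => v * C t u)) // ssE.
  congr EFin.
  transitivity (\sum_t \sum_u (T%:R^-1 * T%:R^-1 * v) * C t u).
    by apply: eq_bigr => t _; apply: eq_bigr => u _; rewrite mulrA.
  under eq_bigr => t _ do rewrite -mulr_sumr.
  by rewrite -mulr_sumr Csum; field.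
have Eb : ('E_P[b] = 0)%E.
  rewrite (expectation_lincomb P D _ (fun=> 0)) //.
  - by rewrite big1 // => t _; rewrite mulr0.
  - by move=> t; apply: Lfun2_Lfun1.
have LV : V \in Lfun P 1.
  apply: (@Lfun_sum _ _ _ _ _ 1 (fun t x => D t x ^+ 2)) => // t.
  exact: (Lfun2_mul_Lfun1 (LD t) (LD t)).
have Ef : ('E_P[f] = eps%:E)%E.
  (* Write [f] as a linear combination of [1], [b], [b ^+ 2] and [V], whose expectations are listed
     in [e]. *)
  pose X (i : 'I_4) : Omega -> R :=
    nth (cst 0) [:: cst 1; b; (fun x => b x ^+ 2); V] i.
  pose a (i : 'I_4) : R := nth 0
    [:: al * (s / k) ^+ 2; - 2 * al * (s / k); al - 1; 1] i.
  pose e (i : 'I_4) : R := nth 0 [:: 1; 0; s ^+ 2; v] i.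
  have -> : f = (fun x => \sum_i (itau^-1 * a i) * X i x).
    apply/funext => x; rewrite !big_ord_recl big_ord0 /= /f /a /X /=.
    by ring.
  rewrite (expectation_lincomb P X _ e) /X /e.
  - congr EFin; rewrite !big_ord_recl big_ord0 /= /a /=.
    have sE : s = s / k * k by rewrite divfK // gt_eqF.
    (* Since [h = s / k * (1 + k ^+ 2)], both sides equal [(s / k) ^+ 2 * (1 + k ^+ 2)]. *)
    have hE : (s / k) ^+ 2 + s ^+ 2 = eps * h ^+ 2.
      rewrite /h {2 3}sE; move: (s / k) => u.
      transitivity (u ^+ 2 * (1 + k ^+ 2) * (eps * (1 + k ^+ 2))); last by ring.
      by rewrite epsE; ring.
    have vE : v - s ^+ 2 = eps * (q * (1 + k ^+ 2)).
      by rewrite mulrCA epsE mulr1 ssE /q; ring.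
    transitivity (itau^-1 * (al * ((s / k) ^+ 2 + s ^+ 2) + (v - s ^+ 2))).
      by ring.
    transitivity (itau^-1 * (eps * (al * h * h + q * (1 + k ^+ 2)))).
      by rewrite hE vE; ring.
    by rewrite alh mulrCA mulVf ?mulr1 // gt_eqF.
  - case=> [[|[|[|[|//]]]]] ? /=.
    + exact: Lfun_cst.
    + exact: Lfun2_Lfun1.
    + exact: (Lfun2_mul_Lfun1 Lb Lb).
    + exact: LV.
  - case=> [[|[|[|[|//]]]]] ? //=.
    exact: expectation_cst.
have PAC : (P (~` A) <= eps%:E)%E.
  rewrite -Ef -expectation_indic; last exact: measurableC.
  apply: expectation_le => //.
  - by apply: measurable_indic; exact: measurableC.
  - apply: aeW => x; rewrite indicE.
    by case: (boolP (x \in ~` A)) => [|//]; rewrite inE => /f_ge1.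
move: PAC; rewrite probability_setC //.
rewrite -(fineK (fin_num_measure P A mA)) -!EFinB !lee_fin.
by lra.
Qed.
End QuantileBound.

(** Completing the square in each period turns growth into a decreasing function of the mean square
    of [1 - port_ret]. *)
Lemma avg_growthE {R : realType} {T N : nat} {Omega : Type} (w : 'cV[R]_N)
    (r : 'I_T -> 'I_N -> Omega -> R) (x : Omega) : (0 < T)%N ->
  avg_growth w r x =
  2^-1 * (1 - T%:R^-1 * \sum_t (1 - port_ret w r t x) ^+ 2).
Proof.
move=> T_gt0; have T0 : T%:R != 0 :> R by rewrite pnatr_eq0 -lt0n.
transitivity (2^-1 * (T%:R^-1 *
    (T%:R - \sum_t (1 - port_ret w r t x) ^+ 2))); last by rewrite mulrBr mulVf.
rewrite /avg_growth mulrCA; congr (_ * _).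
have -> : T%:R = \sum_(t < T) (1 : R) by rewrite sumr_const card_ord.
by rewrite -sumrB mulr_sumr; apply: eq_bigr => t _; field.
Qed.

(** * The extremal law, for an arbitrary parameter [k > 0] *)

Section ExtremalDistribution.
Local Open Scope classical_set_scope.
Context {R : realType} {T N : nat} (mu : 'cV[R]_N) (Sigma : 'M[R]_N).
Context (rho : nat -> R) (w : 'cV[R]_N) (s k : R).
Hypotheses (T2 : (2 <= T)%N) (N_gt0 : (1 <= N)%N).
Hypotheses (symSigma : Sigma^T = Sigma) (posSigma : posdef Sigma).
Hypotheses (rho0 : rho 0%N = 1).
Hypothesis rho_sym : forall t, (1 <= t <= T - 1)%N -> rho t = rho (T - t)%N.
Hypotheses (pos_circ : posdef (circ T rho)) (w0 : w != 0).

Local Notation S := (\sum_(0 <= t < T) rho t).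
Local Notation v := ((w^T *m Sigma *m w) 0 0).
Local Notation wmu := ((w^T *m mu) 0 0).
Hypotheses (k_gt0 : 0 < k) (ssE : s ^+ 2 = v * S / T%:R).

Let T0 : T%:R != 0 :> R.
Proof. by rewrite pnatr_eq0 -lt0n (ltn_trans _ T2). Qed.
Let N0 : N%:R != 0 :> R.
Proof. by rewrite pnatr_eq0 -lt0n. Qed.
Let v_gt0 : 0 < v. Proof. exact: posSigma. Qed.

(** Regression coefficients of the asset returns on the portfolio return. Since [w] pairs with [g]
    to [1], a deviation [c * g i] of the assets moves the portfolio by [c]. *)
Let g i := (Sigma *m w) i 0 / v.

Let wg : \sum_i w i 0 * g i = 1.
Proof.
have -> : \sum_i w i 0 * g i = v / v; last by rewrite divff // gt_eqF.
rewrite -{1}mulmxA mxE mulr_suml; apply: eq_bigr => i _.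
by rewrite mxE mulrA.
Qed.

Lemma residual_factor : exists G : 'I_N -> 'I_N -> R,
  (forall l, \sum_i w i 0 * G i l = 0) /\
  (forall i j, \sum_l G i l * G j l = Sigma i j - v * g i * g j).
Proof.
have [G0 SG] := posdef_factor Sigma symSigma posSigma.
pose y l := \sum_i w i 0 * G0 i l.
exists (fun i l => G0 i l - g i * y l); split=> [l|i j].
  under eq_bigr => i _ do rewrite mulrBr mulrA.
  by rewrite sumrB -mulr_suml wg mul1r subrr.
have Gy i' : \sum_l G0 i' l * y l = v * g i'.
  have -> : v * g i' = (Sigma *m w) i' 0 by rewrite mulrC divfK // gt_eqF.
  rewrite {1}SG -mulmxA mxE; apply: eq_bigr => l _; congr (_ * _).
  by rewrite mxE; apply: eq_bigr => a _; rewrite mxE mulrC.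
have yy : \sum_l y l * y l = v.
  rewrite SG mulmxA -mulmxA mxE; apply: eq_bigr => l _.
  have -> : (w^T *m G0) 0 l = y l.
    by rewrite mxE; apply: eq_bigr => a _; rewrite mxE.
  congr (_ * _).
  by rewrite mxE; apply: eq_bigr => a _; rewrite mxE mulrC.
have -> : Sigma i j = \sum_l G0 i l * G0 j l.
  by rewrite {1}SG mxE; apply: eq_bigr => l _; rewrite mxE.
transitivity (\sum_l (G0 i l * G0 j l - g j * (G0 i l * y l)
                      - g i * (G0 j l * y l) + g i * g j * (y l * y l))).
  by apply: eq_bigr => l _; ring.
rewrite big_split !sumrB /= -!mulr_sumr !Gy yy.
by ring.
Qed.

(** Subtract from each column of [H] its mean. The all-ones vector is an eigenvector of the
    circulant with eigenvalue [S], so centering lowers each entry of the Gram matrix by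
    [S / T%:R]. *)
Lemma centered_circ_factor (H : 'M[R]_T) : circ T rho = H *m H^T ->
  exists h : 'I_T -> 'I_T -> R,
  (forall j, \sum_t h t j = 0) /\
  (forall t u, \sum_j h t j * h u j = circ T rho t u - S / T%:R).
Proof.
move=> CH; pose z j := \sum_t H t j.
exists (fun t j => H t j - T%:R^-1 * z j); split=> [j|t u].
  by rewrite sumrB sumr_const card_ord -(mulr_natl (_ * z j)) mulVKf // subrr.
have CE t' u' : circ T rho t' u' = \sum_j H t' j * H u' j.
  by rewrite CH mxE; apply: eq_bigr => j _; rewrite mxE.
have Hz t' : \sum_j H t' j * z j = S.
  rewrite -(sum_circ_row rho t'); under [RHS]eq_bigr do rewrite CE.
  by rewrite exchange_big; apply: eq_bigr => j _; rewrite mulr_sumr.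
have zz : \sum_j z j * z j = T%:R * S.
  under eq_bigr do rewrite mulr_suml.
  rewrite exchange_big /=; under eq_bigr do rewrite Hz.
  by rewrite sumr_const card_ord -(mulr_natl S).
rewrite CE.
transitivity (\sum_j (H t j * H u j - T%:R^-1 * (H t j * z j)
                      - T%:R^-1 * (H u j * z j) + T%:R^-1 * T%:R^-1 * (z j * z j))).
  by apply: eq_bigr => j _; ring.
rewrite big_split !sumrB /= -!mulr_sumr !Hz zz.
by field.
Qed.

(** A scenario is a sign together with either [inl j], an unfavourable atom along column [j] of [h],
    or [inr (j, l)], a favourable atom with asset noise along column [j] of [H] and column [l] of
    [G]. *)
Let sum_scenarios (F : bool * ('I_T + 'I_T * 'I_N) -> R) :
  \sum_q F q = \sum_j (F (true, inl j) + F (false, inl j)) +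
    \sum_j \sum_l (F (true, inr (j, l)) + F (false, inr (j, l))).
Proof.
have -> : \sum_q F q = \sum_b \sum_c F (b, c).
  by rewrite pair_bigA; apply: eq_bigr => -[].
rewrite exchange_big big_sumType /=.
under eq_bigr => j _ do rewrite big_bool.
under [X in _ + X]eq_bigr => jl _ do rewrite big_bool.
by congr (_ + _); rewrite pair_bigA; apply: eq_bigr => -[].
Qed.

(** The unfavourable scenarios carry mass [1 / (1 + k ^+ 2)], and those of positive probability all
    have exactly the growth bounding [gamma] from below, so only the favourable mass can reach
    [gamma]. *)
Lemma extremal_distribution :
  exists (P : probability nat R) (r : 'I_T -> 'I_N -> nat -> R),
    in_ambiguity_set mu Sigma rho P r /\
    forall gamma, 2^-1 * (1 - ((1 - wmu + k * s) ^+ 2 +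
                      v * (1 - S / T%:R) * (1 + k ^+ 2))) < gamma ->
      (P [set x | (gamma <= avg_growth w r x)%R] <=
        (k ^+ 2 / (1 + k ^+ 2))%:E)%E.
Proof.
have [H CH] := posdef_factor _ (circ_sym rho rho_sym) pos_circ.
have [h [h_sum hh]] := centered_circ_factor H CH.
have [G [wG GG]] := residual_factor.
have CE t u : circ T rho t u = \sum_j H t j * H u j.
  by rewrite CH mxE; apply: eq_bigr => j _; rewrite mxE.
pose n j := \sum_t h t j ^+ 2; pose nu := T%:R - S.
have nu_gt0 : 0 < nu by rewrite subr_gt0 sum_circ_lt.
have n_ge0 j : 0 <= n j by rewrite sumr_ge0 // => t _; rewrite sqr_ge0.
have n_sum : \sum_j n j = nu.
  rewrite exchange_big /=.
  under eq_bigr => t _ do rewrite hh circ_diag //.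
  rewrite sumr_const card_ord -(mulr_natl (1 - _)) /nu.
  by field.
have n_eq0 t j : n j = 0 -> h t j = 0.
  move/eqP; rewrite psumr_eq0 => [/allP/(_ t)|u _]; last by rewrite sqr_ge0.
  by rewrite mem_index_enum /= sqrf_eq0 => /(_ isT)/eqP.
have k1_gt0 : 0 < 1 + k ^+ 2 by rewrite ltr_pwDl // sqr_ge0.
pose e := (1 + k ^+ 2)^-1.
have e_gt0 : 0 < e by rewrite invr_gt0.
have eE : e + k ^+ 2 * e = 1 by rewrite /e; field; rewrite gt_eqF.
have [nu0 k0 e0] : [/\ nu != 0, k != 0 & e != 0] by rewrite !gt_eqF.
(* Chosen so that [beta j ^+ 2 * n j] is the same for all [j] with [n j != 0], while weights
   proportional to [n j] give covariance [v * h t j * h u j]. A column with [n j = 0] vanishes and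
   has probability zero. *)
pose beta j := Num.sqrt (v * nu / (e * n j)).
(* Compensates the probability of a noise pair [(j, l)], both signs together, so that each
   contributes exactly the product of its [H] and [G] entries. *)
pose beta0 := Num.sqrt (T%:R * N%:R / (k ^+ 2 * e)).
pose sg (b : bool) : R := if b then 1 else -1.
pose p (q : bool * ('I_T + 'I_T * 'I_N)) : R :=
  match q.2 with
  | inl j => e * n j / nu / 2
  | inr _ => k ^+ 2 * e / (T%:R * N%:R) / 2
  end.
pose D (q : bool * ('I_T + 'I_T * 'I_N)) t i : R :=
  match q.2 with
  | inl j => (sg q.1 * beta j * h t j - k * s) * g i
  | inr (j, l) => s / k * g i + sg q.1 * beta0 * H t j * G i l
  end.
have p_ge0 q : 0 <= p q.
  have [e_ge0 nu_ge0] := (ltW e_gt0, ltW nu_gt0).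
  case: q => b [j|jl]; rewrite /p /=.
    by rewrite divr_ge0 // divr_ge0 // mulr_ge0.
  by rewrite divr_ge0 // divr_ge0 // mulr_ge0 // sqr_ge0.
have p_sum : \sum_q p q = 1.
  rewrite sum_scenarios /p /=.
  under eq_bigr do rewrite -splitr.
  under [X in _ + X]eq_bigr do under eq_bigr do rewrite -splitr.
  rewrite -mulr_suml -mulr_sumr n_sum.
  under [X in _ + X]eq_bigr do rewrite sumr_const card_ord.
  rewrite sumr_const card_ord -mulrnA -[X in _ + X]mulr_natl natrM.
  rewrite -[RHS]eE; field.
  by rewrite N0 T0 nu0.
have mean_cst c : \sum_(j < T) \sum_(l < N) k ^+ 2 * e / (T%:R * N%:R) * c =
    k ^+ 2 * e * c.
  under eq_bigr do rewrite sumr_const card_ord.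
  rewrite sumr_const card_ord -mulrnA -[LHS]mulr_natl natrM.
  by field; rewrite N0 T0.
have beta_sqr t u j : e * n j / nu * beta j ^+ 2 * (h t j * h u j) =
    v * (h t j * h u j).
  have [nj0|nj0] := eqVneq (n j) 0; first by rewrite !(n_eq0 _ _ nj0) !(mul0r, mulr0).
  rewrite sqr_sqrtr; last by rewrite divr_ge0 // mulr_ge0 // ltW.
  field; by rewrite nj0 !gt_eqF.
have beta0_sqr : k ^+ 2 * e / (T%:R * N%:R) * beta0 ^+ 2 = 1.
  rewrite sqr_sqrtr; last by rewrite divr_ge0 // mulr_ge0 // ?sqr_ge0 // ltW.
  field; by rewrite N0 T0 !gt_eqF.
have p_mean t i : \sum_q p q * D q t i = 0.
  rewrite sum_scenarios /p /D /=.
  transitivity (\sum_j (e / nu * - (k * s) * g i) * n j +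
      \sum_(j < T) \sum_(l < N) k ^+ 2 * e / (T%:R * N%:R) * (s / k * g i)).
    congr (_ + _); apply: eq_bigr => j _; last apply: eq_bigr => l _.
      by rewrite /sg; field; rewrite nu0.
    by rewrite /sg; field; rewrite N0 T0 k0.
  rewrite -mulr_sumr n_sum mean_cst; field.
  by rewrite nu0 k0.
have p_cov t u i j : \sum_q p q * (D q t i * D q u j) = circ T rho t u * Sigma i j.
  rewrite sum_scenarios /p /D /=.
  transitivity (\sum_l (e / nu * (k * s) ^+ 2 * g i * g j * n l +
                         v * g i * g j * (h t l * h u l)) +
      \sum_(a < T) \sum_(l < N) (k ^+ 2 * e / (T%:R * N%:R) *
         ((s / k) ^+ 2 * g i * g j) + (H t a * H u a) * (G i l * G j l))).
    congr (_ + _); apply: eq_bigr => a _.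
      rewrite (_ : v * g i * g j * _ = g i * g j * (v * (h t a * h u a))); last by ring.
      rewrite -beta_sqr /sg; field.
      by rewrite nu0.
    apply: eq_bigr => l _.
    rewrite (_ : H t a * H u a * _ = k ^+ 2 * e / (T%:R * N%:R) * beta0 ^+ 2 *
      (H t a * H u a * (G i l * G j l))); last by rewrite beta0_sqr mul1r.
    rewrite /sg; field.
    by rewrite N0 T0.
  rewrite big_split /= -!mulr_sumr n_sum hh.
  under [X in _ + X]eq_bigr => a _ do rewrite big_split /= -[X in _ + X]mulr_sumr GG.
  rewrite big_split /= mean_cst -mulr_suml -CE.
  (* The two levels [- k * s] and [s / k] give the time average variance [s ^+ 2 = v * S / T%:R],
     which restores what centering removed; the remaining [v * g i * g j] terms cancel. *)
  transitivity (s ^+ 2 * (e + k ^+ 2 * e) * g i * g j +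
     v * g i * g j * (circ T rho t u - S / T%:R) +
     circ T rho t u * (Sigma i j - v * g i * g j)).
    by field; rewrite T0 k0 nu0.
  by rewrite eE ssE; ring.
have T_gt0 : (0 < T)%N by rewrite (ltn_trans _ T2).
have [P [x EP]] := finite_probability p (true, inl (Ordinal T_gt0)) p_ge0 p_sum.
pose r t i y := mu i 0 + D (x y) t i.
have Er t i : ('E_P[r t i] = (mu i 0)%:E)%E.
  have [_] := EP (fun q => mu i 0 + D q t i); rewrite /comp -/(r t i) => ->.
  congr EFin.
  under eq_bigr => q _ do rewrite mulrDr.
  by rewrite big_split /= p_mean -mulr_suml p_sum mul1r addr0.
exists P, r; split.
  split; first by move=> t i; have [] := EP (fun q => mu i 0 + D q t i).
  split=> [//|t u i j].
  have [_] := EP (fun q => D q t i * D q u j); rewrite p_cov mxE => <-.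
  rewrite unlock !Er; congr (expectation P _); apply/funext => y.
  change ((mu i 0 + D (x y) t i - mu i 0) * (mu j 0 + D (x y) u j - mu j 0) =
          D (x y) t i * D (x y) u j).
  by ring.
have port_r t y : 1 - port_ret w r t y =
    match (x y).2 with
    | inl j => (1 - wmu + k * s) - sg (x y).1 * beta j * h t j
    | inr _ => (1 - wmu) - s / k
    end.
  have -> : port_ret w r t y = wmu + \sum_i w i 0 * D (x y) t i.
    rewrite /port_ret mxE -big_split; apply: eq_bigr => i _ /=.
    by rewrite mxE -mulrDr.
  rewrite /D; case: (x y).2 => [j|[j l]] /=.
    under eq_bigr => i _ do rewrite mulrCA.
    by rewrite -mulr_sumr wg; ring.
  under eq_bigr => i _ do rewrite mulrDr mulrCA [X in _ + X]mulrCA.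
  by rewrite big_split /= -!mulr_sumr wg wG; ring.
move=> gamma gt_gamma.
(* The scenarios that may reach [gamma]. Null columns are included because there the constant norm
   fails; they add no probability. *)
pose A : {pred bool * ('I_T + 'I_T * 'I_N)} :=
  fun q => if q.2 is inl j then n j == 0 else true.
have PA : ('E_P[(fun y => (A (x y))%:R)%R] = (k ^+ 2 / (1 + k ^+ 2))%:E)%E.
  have [_] := EP (fun q => (A q)%:R); rewrite /comp => ->.
  congr EFin; rewrite sum_scenarios /p /A /= big1 ?add0r => [|j _].
    transitivity (\sum_(j < T) \sum_(l < N) k ^+ 2 * e / (T%:R * N%:R) * 1).
      by apply: eq_bigr => j _; apply: eq_bigr => l _; field; rewrite N0 T0.
    by rewrite mean_cst mulr1.
  by case: eqP => [->|_]; rewrite !(mulr0, mul0r, addr0).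
rewrite -PA -expectation_indic //.
apply: expectation_le => //.
apply: aeW => y; rewrite indicE; case: (boolP (y \in _)) => [|_]; last by rewrite ler0n.
rewrite inE /= avg_growthE // ler_nat => le_gamma.
rewrite lt0n; apply/eqP => /eqP; rewrite eqb0 /A.
move: le_gamma; under eq_bigr => t _ do rewrite port_r.
case: (x y) => b [j|//] /= le_gamma nj0.
move: le_gamma; rewrite leNgt => /negP; apply; apply: le_lt_trans gt_gamma.
rewrite ler_pM2l ?invr_gt0 // lerD2l lerN2.
set a := 1 - wmu + k * s; set c := sg b * beta j.
have -> : \sum_t (a - c * h t j) ^+ 2 = T%:R * a ^+ 2 + c ^+ 2 * n j.
  transitivity (\sum_t (a ^+ 2 - 2 * a * c * h t j + c ^+ 2 * h t j ^+ 2)).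
    by apply: eq_bigr => t _; ring.
  rewrite big_split sumrB /= sumr_const card_ord -(mulr_natl (a ^+ 2)).
  by rewrite -!mulr_sumr h_sum mulr0 subr0.
have -> : c ^+ 2 = v * nu / (e * n j).
  rewrite exprMn sqr_sqrtr; last by rewrite divr_ge0 // mulr_ge0 // ltW.
  by rewrite /sg; case: (b); rewrite ?sqrrN expr1n mul1r.
have -> : 1 + k ^+ 2 = e^-1 by rewrite invrK.
rewrite le_eqVlt; apply/orP; left; apply/eqP.
have -> : 1 - S / T%:R = nu / T%:R by rewrite mulrBl divff.
by field; rewrite T0 e0 nj0.
Qed.
End ExtremalDistribution.

(** * Passage to the critical parameter and the growth formula *)

Lemma quadratic_le_left_limit {R : realFieldType} (a b c k y : R) :
  0 <= a -> 0 <= b -> 0 < k ->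
  (forall x, 0 < x < k -> y <= c - b * x - a * x ^+ 2) ->
  y <= c - b * k - a * k ^+ 2.
Proof.
move=> a0 b0 k0 le_y; rewrite leNgt; apply/negP => lt_y.
set F := c - b * k - a * k ^+ 2 in lt_y.
(* A positive Lipschitz constant for the quadratic on [[0, k]]. *)
pose B := b + 2 * a * k + 1.
have B_gt0 : 0 < B by rewrite /B; nra.
(* Close enough to [k] to change the value by at most half of the gap [y - F]; the maximum with
   [k / 2] keeps [x] positive. *)
pose x := Num.max (k / 2) (k - (y - F) / 2 / B).
have dB_gt0 : 0 < (y - F) / 2 / B by rewrite !divr_gt0 //; lra.
have xk : 0 < x < k by rewrite lt_max gt_max; apply/andP; split; lra.
have /andP[x0 ltxk] := xk.
have x_ge : k - (y - F) / 2 / B <= x by rewrite le_max lexx orbT.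
have le1 : (k - x) * B <= (y - F) / 2 by rewrite -ler_pdivlMr //; lra.
have := le_y x xk.
have -> : c - b * x - a * x ^+ 2 = F + (k - x) * (b + a * (k + x)) by rewrite /F; ring.
have : (k - x) * (b + a * (k + x)) <= (k - x) * B by rewrite ler_wpM2l // /B; nra.
lra.
Qed.
Lemma avg_growth0 {R : realType} {T N : nat} {Omega : Type}
    (r : 'I_T -> 'I_N -> Omega -> R) (x : Omega) : avg_growth 0 r x = 0.
Proof.
rewrite /avg_growth big1 ?mulr0 // => t _.
rewrite /port_ret big1 => [|i _]; last by rewrite mxE mul0r.
by rewrite expr0n mulr0 subr0.
Qed.

Theorem theorem4p3 (R : realType) (T N : nat) (eps : R)
    (mu : 'cV[R]_N) (Sigma : 'M[R]_N) (rho : nat -> R) (w : 'cV[R]_N) :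
  (2 <= T)%N -> (1 <= N)%N -> 0 < eps < 1 ->
  Sigma^T = Sigma -> posdef Sigma ->
  rho 0%N = 1 -> (forall t, (1 <= t <= T - 1)%N -> rho t = rho (T - t)%N) ->
  posdef (circ T rho) ->
  (forall i, 0 <= w i 0) ->
  let rhobar := T.-1%:R^-1 * \sum_(1 <= t < T) rho t in
  let wmu := (w^T *m mu) 0 0 in
  let wSw := (w^T *m Sigma *m w) 0 0 in
  1 - wmu > Num.sqrt ((1 + T.-1%:R * rhobar) * eps / ((1 - eps) * T%:R))
            * sqrt_quad Sigma w ->
  worst_growth T eps mu Sigma rho w =
    2^-1 * (1 - (1 - wmu + Num.sqrt ((1 - eps) * (1 + T.-1%:R * rhobar)
                                      / (eps * T%:R)) * sqrt_quad Sigma w) ^+ 2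
           - (T.-1%:R - T.-1%:R * rhobar) / (eps * T%:R) * wSw).
Proof.
move=> T2 N1 /andP[eps_gt0 eps_lt1] symSigma posSigma rho0 rho_sym pos_circ _.
move=> rhobar wmu wSw.
set S := \sum_(0 <= t < T) rho t.
have T_gt0 : (0 < T)%N by rewrite (ltn_trans _ T2).
have T0 : T%:R != 0 :> R by rewrite pnatr_eq0 -lt0n.
have TR_gt0 : 0 < T%:R :> R by rewrite ltr0n.
have T1E : T.-1%:R = T%:R - 1 :> R by rewrite -subn1 natrB.
have rhobarE : T.-1%:R * rhobar = S - 1.
  rewrite mulVKf; last by rewrite pnatr_eq0 -lt0n -ltnS prednK.
  by rewrite /S [in RHS]big_ltn // rho0 addrAC subrr add0r.
have -> : 1 + T.-1%:R * rhobar = S by rewrite rhobarE addrC subrK.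
have -> : T.-1%:R - T.-1%:R * rhobar = T%:R - S by rewrite rhobarE T1E; ring.
have S_gt0 : 0 < S by exact: sum_circ_gt0.
have S_lt : S < T%:R by exact: sum_circ_lt.
pose k := Num.sqrt ((1 - eps) / eps).
have k_gt0 : 0 < k by rewrite sqrtr_gt0 divr_gt0 // subr_gt0.
have kkE : k ^+ 2 = (1 - eps) / eps.
  by rewrite sqr_sqrtr // divr_ge0 ?subr_ge0 // ltW.
have eps0 : eps != 0 by rewrite gt_eqF.
have epsE : eps * (1 + k ^+ 2) = 1 by rewrite kkE; field.
(* The standard deviation of the time-averaged portfolio return. *)
pose s := Num.sqrt (S / T%:R) * sqrt_quad Sigma w.
have -> : Num.sqrt (S * eps / ((1 - eps) * T%:R)) * sqrt_quad Sigma w = s / k.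
  have -> : S * eps / ((1 - eps) * T%:R) = S / T%:R * ((1 - eps) / eps)^-1.
    by field; rewrite eps0 T0 subr_eq0 eq_sym lt_eqF.
  rewrite sqrtrM; last by rewrite divr_ge0 // ltW.
  by rewrite sqrtrV ?divr_ge0 ?subr_ge0 1?ltW // mulrAC.
have -> : Num.sqrt ((1 - eps) * S / (eps * T%:R)) * sqrt_quad Sigma w = k * s.
  have -> : (1 - eps) * S / (eps * T%:R) = (1 - eps) / eps * (S / T%:R).
    by field; rewrite eps0 T0.
  by rewrite sqrtrM ?mulrA // divr_ge0 ?subr_ge0 // ltW.
move=> m_gt.
have wSw_ge0 : 0 <= wSw.
  have [w0|/posSigma /ltW//] := eqVneq w 0.
  by rewrite /wSw w0 mulmx0 mxE.
have ssE : s ^+ 2 = wSw * S / T%:R.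
  rewrite exprMn !sqr_sqrtr ?divr_ge0 ?(ltW S_gt0) //.
  by rewrite mulrC mulrA.
have s_ge0 : 0 <= s by rewrite mulr_ge0 ?sqrtr_ge0.
set q := wSw * (1 - S / T%:R).
have q_ge0 : 0 <= q.
  by rewrite mulr_ge0 // subr_ge0 ler_pdivrMr // mul1r ltW.
set F := 2^-1 * _.
have FE : F = 2^-1 * (1 - ((1 - wmu + k * s) ^+ 2 + q * (1 + k ^+ 2))).
  by rewrite /F kkE /q; field; rewrite eps0 T0.
have csum : \sum_t \sum_u circ T rho t u = T%:R * S.
  under eq_bigr => t _ do rewrite sum_circ_row.
  by rewrite sumr_const card_ord -(mulr_natl S).
(* The supremum is attained: [F] itself is a guaranteed growth rate. *)
have sup_max (A : set R) : A F -> (forall y, A y -> y <= F) -> sup A = F.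
  move=> AF ubF; apply/eqP; rewrite eq_le; apply/andP; split.
    by apply: ge_sup; [exists F | exact: ubF].
  by apply: ub_le_sup => //; exists F; exact: ubF.
have F0 : w = 0 -> F = 0.
  move=> w0; rewrite FE /q /s /sqrt_quad -/wSw.
  have -> : wSw = 0 by rewrite /wSw w0 mulmx0 mxE.
  have -> : wmu = 0 by rewrite /wmu w0 trmx0 mul0mx mxE.
  by rewrite sqrtr0; ring.
apply: sup_max.
  move=> d Omega P r rP.
  (* The upper bound needs [s > 0], so the zero portfolio is separate; its growth is identically
     [0]. *)
  have [w0|w0] := eqVneq w 0.
    rewrite (_ : [set x | _]%classic = setT%classic) ?probability_setT ?lee_fin.
      by lra.
    by apply/seteqP; split=> // x _ /=; rewrite w0 avg_growth0 F0.
  have s_gt0 : 0 < s.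
    by rewrite mulr_gt0 // sqrtr_gt0 ?divr_gt0 // posSigma.
  have := mean_sqr_quantile P (fun t x => port_ret w r t x - wmu)
    (circ T rho) wSw S (1 - wmu) s k eps (port_dev_Lfun2 _ _ _ _ _ _ rP)
    (expectation_port_dev _ _ _ _ _ _ rP) (expectation_port_dev_mul _ _ _ _ _ _ rP)
    (circ_diag rho rho0) csum T_gt0 wSw_ge0 (ltW S_lt) s_gt0 ssE k_gt0 epsE m_gt.
  congr (_ <= P _)%E; apply/funext => x /=; rewrite avg_growthE // FE.
  rewrite ler_pM2l ?invr_gt0 // lerD2l lerN2 /q.
  by congr (is_true (_ * _ <= _)); apply: eq_bigr => t _; rewrite opprB addrA subrK.
move=> y yP.
have [w0|w0] := eqVneq w 0.
  (* For [w = 0] any admissible law refutes [y > 0]. One is obtained from the extremal construction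
     for the all-ones portfolio with parameter [1]. *)
  have v0 : const_mx 1 != 0 :> 'cV[R]_N.
    by apply/eqP => /matrixP/(_ (Ordinal N1) 0)/eqP; rewrite !mxE oner_eq0.
  pose v := ((const_mx 1)^T *m Sigma *m const_mx 1 : 'M[R]_1) 0 0.
  have vvE : Num.sqrt (v * S / T%:R) ^+ 2 = v * S / T%:R.
    by rewrite sqr_sqrtr // divr_ge0 // mulr_ge0 // ltW // posSigma.
  have [P [r [rP _]]] := extremal_distribution mu Sigma rho (const_mx 1) _ 1
    T2 N1 symSigma posSigma rho0 rho_sym pos_circ v0 ltr01 vvE.
  rewrite F0 // leNgt; apply/negP => y_gt0.
  have := yP _ _ P r rP.
  rewrite (_ : [set x | _]%classic = set0%classic) ?measure0 ?lee_fin; first by lra.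
  by apply/seteqP; split=> // x /=; rewrite w0 avg_growth0 leNgt y_gt0.
rewrite FE.
have -> : 2^-1 * (1 - ((1 - wmu + k * s) ^+ 2 + q * (1 + k ^+ 2))) =
  2^-1 * (1 - (1 - wmu) ^+ 2 - q) - ((1 - wmu) * s) * k - 2^-1 * (s ^+ 2 + q) * k ^+ 2.
  by field.
apply: (quadratic_le_left_limit _ _ _ _ _ _ _ k_gt0).
- by rewrite mulr_ge0 ?invr_ge0 // addr_ge0 ?sqr_ge0.
- by rewrite mulr_ge0 // (le_trans _ (ltW m_gt)) // divr_ge0 // ltW.
(* At [x = k] the favourable mass is exactly [1 - eps], which contradicts nothing; for [x < k] it is
   strictly smaller, so [y] cannot exceed the value at [x]. *)
move=> x /andP[x_gt0 x_lt].
rewrite leNgt; apply/negP => Fx_lt.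
have [P [r [rP Pr]]] := extremal_distribution mu Sigma rho w s x T2 N1 symSigma
  posSigma rho0 rho_sym pos_circ w0 x_gt0 ssE.
have : (1 - eps <= x ^+ 2 / (1 + x ^+ 2)).
  by rewrite -lee_fin; apply: le_trans (yP _ _ P r rP) (Pr y _); move: Fx_lt;
    congr (is_true (_ < _)); rewrite -/wmu -/wSw -/S -/q; field.
rewrite ler_pdivlMr; last by rewrite ltr_pwDl // sqr_ge0.
have : eps * x ^+ 2 < eps * k ^+ 2 by rewrite ltr_pM2l // ltr_pXn2r ?nnegrE // ltW.
lra.
Qed.
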